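(* Assume that the set $X$ is infinite. There exists a Hall set $\mathcal{B} \subset \mathrm{Br}(X)$ such that, for every $n \geq 2$, there exist $a < b \in \mathcal{B}$ with $|a| = 1$, $\theta_a(b) = |b| = n$ and $$\|[a,b]\|_{\mathcal{B}} = \lfloor e\,(n-1)! \rfloor,$$ where $e$ is Euler's number.
   Context: The base field is $\mathbb{K}=\mathbb{R}$ or $\mathbb{C}$. $\mathrm{Br}(X)$ is the free magma over $X$: the set of formal binary brackets (rooted planar binary trees with leaves labelled by elements of $X$), with product $(t_1,t_2)$. For $t\in \mathrm{Br}(X)$, $|t|$ is its number of leaves; if $t\notin X$, $t$ is written uniquely as $t=(\lambda(t),\mu(t))$. $\mathcal{L}(X)$ is the free Lie algebra over $X$ and $\mathrm{ev}:\mathrm{Br}(X)\to\mathcal{L}(X)$ is the canonical evaluation ($\mathrm{ev}(x)=x$ for $x\in X$, $\mathrm{ev}((t_1,t_2))=[\mathrm{ev}(t_1),\mathrm{ev}(t_2)]$). For $a,b\in\mathrm{Br}(X)$, $[a,b]$ denotes $[\mathrm{ev}(a),\mathrm{ev}(b)]\in\mathcal{L}(X)$. A Hall set is a subset $\mathcal{B}\subset\mathrm{Br}(X)$ endowed with a total order $<$ such that: (i) $X\subset\mathcal{B}$; (ii) for all $b_1,b_2\in\mathrm{Br}(X)$, $(b_1,b_2)\in\mathcal{B}$ iff $b_1,b_2\in\mathcal{B}$, $b_1<b_2$ and either $b_2\in X$ or $\lambda(b_2)\leq b_1$; (iii) for all $b_1,b_2\in\mathcal{B}$ with $(b_1,b_2)\in\mathcal{B}$,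 $b_1<(b_1,b_2)$. By a theorem of Viennot, $\mathrm{ev}$ is injective on $\mathcal{B}$ and $\mathrm{ev}(\mathcal{B})$ is a basis of $\mathcal{L}(X)$. For $u=\sum_{c\in\mathcal{B}}\alpha_c\,\mathrm{ev}(c)\in\mathcal{L}(X)$ (finite sum), $\|u\|_{\mathcal{B}}:=\sum_{c}|\alpha_c|$. For $a<b\in\mathcal{B}$, the relative folding $T_a(b)$ is the binary tree with leaves labelled by elements of $\mathcal{B}$ defined inductively by: $T_a(b):=b$ (a single leaf) if $(a,b)\in\mathcal{B}$; otherwise (then $b\notin X$ and $a<\lambda(b)<\mu(b)$) $T_a(b)$ is the tree with left subtree $T_a(\lambda(b))$ and right subtree $T_a(\mu(b))$. $\theta_a(b)$ is the number of leaves of $T_a(b)$. *)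

(* Defs.v *)
From HB Require Import structures.
From mathcomp Require Import all_boot all_order all_algebra.
From mathcomp Require Import generic_quotient complex.
From mathcomp Require Import all_classical all_reals all_analysis.

Set Implicit Arguments.
Unset Strict Implicit.
Unset Printing Implicit Defensive.

Import Order.TTheory GRing.Theory Num.Theory.
Local Open Scope classical_set_scope.
Local Open Scope quotient_scope.
Local Open Scope ring_scope.

Variant base_field := RealBase | ComplexBase.

Definition scalars (R : realType) (k : base_field) : numFieldType :=
  match k with
  | RealBase => R
  | ComplexBase => R[i]
  end.

Inductive Br (X : Type) : Type :=
  | Leaf of X
  | Node of Br X & Br X.

HB.instance Definition _ (X : Type) := gen_eqMixin (Br X).
HB.instance Definition _ (X : Type) := gen_choiceMixin (Br X).

Fixpoint leaves (X : Type) (t : Br X) : nat :=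
  match t with
  | Leaf _ => 1
  | Node l m => leaves l + leaves m
  end.

(* The free Lie algebra is the quotient of the formal expressions built from  *)
(* letters, module operations and bracket by the congruence [lie_eq]          *)
(* generated by the axioms of Lie algebras.                                   *)
Section FreeLie.
Variables (K : numFieldType) (X : Type).

Inductive lie_term : Type :=
  | LVar of X
  | LZero
  | LAdd of lie_term & lie_term
  | LScale of K & lie_term
  | LLie of lie_term & lie_term.

HB.instance Definition _ := gen_eqMixin lie_term.
HB.instance Definition _ := gen_choiceMixin lie_term.

Inductive lie_eq : lie_term -> lie_term -> Prop :=
  | LE_refl x : lie_eq x x
  | LE_sym x y : lie_eq x y -> lie_eq y x
  | LE_trans y x z : lie_eq x y -> lie_eq y z -> lie_eq x z
  | LE_add x x' y y' :
      lie_eq x x' -> lie_eq y y' -> lie_eq (LAdd x y) (LAdd x' y')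
  | LE_scale k x x' : lie_eq x x' -> lie_eq (LScale k x) (LScale k x')
  | LE_lie x x' y y' :
      lie_eq x x' -> lie_eq y y' -> lie_eq (LLie x y) (LLie x' y')
  | LE_addA x y z : lie_eq (LAdd x (LAdd y z)) (LAdd (LAdd x y) z)
  | LE_addC x y : lie_eq (LAdd x y) (LAdd y x)
  | LE_add0 x : lie_eq (LAdd LZero x) x
  | LE_addN x : lie_eq (LAdd (LScale (-1) x) x) LZero
  | LE_scaleA k l x : lie_eq (LScale k (LScale l x)) (LScale (k * l) x)
  | LE_scale1 x : lie_eq (LScale 1 x) x
  | LE_scaleDr k x y :
      lie_eq (LScale k (LAdd x y)) (LAdd (LScale k x) (LScale k y))
  | LE_scaleDl x k l :
      lie_eq (LScale (k + l) x) (LAdd (LScale k x) (LScale l x))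
  | LE_lieDl x y z : lie_eq (LLie (LAdd x y) z) (LAdd (LLie x z) (LLie y z))
  | LE_lieDr x y z : lie_eq (LLie x (LAdd y z)) (LAdd (LLie x y) (LLie x z))
  | LE_lieZl k x y : lie_eq (LLie (LScale k x) y) (LScale k (LLie x y))
  | LE_lieZr k x y : lie_eq (LLie x (LScale k y)) (LScale k (LLie x y))
  | LE_liexx x : lie_eq (LLie x x) LZero
  | LE_jacobi x y z :
      lie_eq (LAdd (LLie x (LLie y z))
                (LAdd (LLie y (LLie z x)) (LLie z (LLie x y)))) LZero.

Definition lie_eqb (x y : lie_term) : bool := `[< lie_eq x y >].

Lemma lie_eqb_refl : reflexive lie_eqb.
Proof. by move=> x; apply/asboolP; exact: LE_refl. Qed.

Lemma lie_eqb_sym : symmetric lie_eqb.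
Proof.
by move=> x y; apply/asboolP/asboolP => h; exact: LE_sym.
Qed.

Lemma lie_eqb_trans : transitive lie_eqb.
Proof.
move=> y x z /asboolP xy /asboolP yz; apply/asboolP; exact: LE_trans yz.
Qed.

Canonical lie_equiv := EquivRel lie_eqb lie_eqb_refl lie_eqb_sym lie_eqb_trans.

Definition free_lie := {eq_quot lie_equiv}.

HB.instance Definition _ := Choice.on free_lie.
HB.instance Definition _ := EqQuotient.on free_lie.

Implicit Types (u v w : free_lie) (x y z : lie_term).

Definition fl_pi x : free_lie := \pi_free_lie x.

Lemma fl_piP x y : fl_pi x = fl_pi y <-> lie_eq x y.
Proof. by split=> [/eqmodP/asboolP//|h]; apply/eqmodP/asboolP. Qed.

Lemma fl_piK u : fl_pi (repr u) = u.
Proof. exact: reprK. Qed.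

Lemma fl_ind (P : free_lie -> Prop) : (forall x, P (fl_pi x)) -> forall u, P u.
Proof. by move=> h u; rewrite -(fl_piK u). Qed.

Lemma repr_pi x : lie_eq (repr (fl_pi x)) x.
Proof. by apply/fl_piP; rewrite fl_piK. Qed.

Definition fl_add u v : free_lie := fl_pi (LAdd (repr u) (repr v)).
Definition fl_scale k u : free_lie := fl_pi (LScale k (repr u)).
Definition fl_opp u : free_lie := fl_scale (-1) u.
Definition fl_zero : free_lie := fl_pi LZero.
Definition lie u v : free_lie := fl_pi (LLie (repr u) (repr v)).

Lemma fl_addE x y : fl_add (fl_pi x) (fl_pi y) = fl_pi (LAdd x y).
Proof. by apply/fl_piP/LE_add; exact: repr_pi. Qed.

Lemma fl_scaleE k x : fl_scale k (fl_pi x) = fl_pi (LScale k x).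
Proof. by apply/fl_piP/LE_scale; exact: repr_pi. Qed.

Lemma lie_piE x y : lie (fl_pi x) (fl_pi y) = fl_pi (LLie x y).
Proof. by apply/fl_piP/LE_lie; exact: repr_pi. Qed.

Lemma fl_addA : associative fl_add.
Proof.
elim/fl_ind=> x; elim/fl_ind=> y; elim/fl_ind=> z.
by rewrite !fl_addE; apply/fl_piP; exact: LE_addA.
Qed.

Lemma fl_addC : commutative fl_add.
Proof.
elim/fl_ind=> x; elim/fl_ind=> y.
by rewrite !fl_addE; apply/fl_piP; exact: LE_addC.
Qed.

Lemma fl_add0 : left_id fl_zero fl_add.
Proof. by elim/fl_ind=> x; rewrite fl_addE; apply/fl_piP; exact: LE_add0. Qed.

Lemma fl_addN : left_inverse fl_zero fl_opp fl_add.
Proof.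
elim/fl_ind=> x; rewrite /fl_opp fl_scaleE fl_addE.
by apply/fl_piP; exact: LE_addN.
Qed.

HB.instance Definition _ :=
  GRing.isZmodule.Build free_lie fl_addA fl_addC fl_add0 fl_addN.

Lemma fl_scaleA k l u : fl_scale k (fl_scale l u) = fl_scale (k * l) u.
Proof.
by elim/fl_ind: u => x; rewrite !fl_scaleE; apply/fl_piP; exact: LE_scaleA.
Qed.

Lemma fl_scale1 : left_id 1 fl_scale.
Proof.
by elim/fl_ind=> x; rewrite fl_scaleE; apply/fl_piP; exact: LE_scale1.
Qed.

Lemma fl_scaleDr : right_distributive fl_scale +%R.
Proof.
move=> k; elim/fl_ind=> x; elim/fl_ind=> y; rewrite /GRing.add /=.
by rewrite !(fl_scaleE, fl_addE); apply/fl_piP; exact: LE_scaleDr.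
Qed.

Lemma fl_scaleDl u : {morph fl_scale^~ u : k l / k + l}.
Proof.
move=> k l /=; elim/fl_ind: u => x; rewrite [RHS]/GRing.add /=.
by rewrite !(fl_scaleE, fl_addE); apply/fl_piP; exact: LE_scaleDl.
Qed.

HB.instance Definition _ := GRing.Zmodule_isLmodule.Build K free_lie
  fl_scaleA fl_scale1 fl_scaleDr fl_scaleDl.

Definition fl_var (i : X) : free_lie := fl_pi (LVar i).

End FreeLie.

Record is_lie_bracket (K : numFieldType) (V : lmodType K) (b : V -> V -> V) :
    Prop := IsLieBracket {
  lie_bracketDl : forall u v w, b (u + v) w = b u w + b v w;
  lie_bracketDr : forall u v w, b u (v + w) = b u v + b u w;
  lie_bracketZl : forall k u v, b (k *: u) v = k *: b u v;
  lie_bracketZr : forall k u v, b u (k *: v) = k *: b u v;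
  lie_bracketxx : forall u, b u u = 0;
  lie_jacobi : forall u v w, b u (b v w) + (b v (b w u) + b w (b u v)) = 0
}.

Section FreeLieTheory.
Variables (K : numFieldType) (X : Type).
Local Notation L := (free_lie K X).

Let fl_addD (x y : lie_term K X) : fl_pi x + fl_pi y = fl_pi (LAdd x y).
Proof. exact: fl_addE. Qed.

Let fl_scaleD k (x : lie_term K X) : k *: fl_pi x = fl_pi (LScale k x).
Proof. exact: fl_scaleE. Qed.

Lemma free_lie_bracket : is_lie_bracket (@lie K X).
Proof.
split.
- elim/fl_ind=> x; elim/fl_ind=> y; elim/fl_ind=> z.
  by rewrite fl_addD !lie_piE fl_addD; apply/fl_piP; exact: LE_lieDl.
- elim/fl_ind=> x; elim/fl_ind=> y; elim/fl_ind=> z.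
  by rewrite fl_addD !lie_piE fl_addD; apply/fl_piP; exact: LE_lieDr.
- move=> k; elim/fl_ind=> x; elim/fl_ind=> y.
  by rewrite fl_scaleD !lie_piE fl_scaleD; apply/fl_piP; exact: LE_lieZl.
- move=> k; elim/fl_ind=> x; elim/fl_ind=> y.
  by rewrite fl_scaleD !lie_piE fl_scaleD; apply/fl_piP; exact: LE_lieZr.
- by elim/fl_ind=> x; rewrite lie_piE; apply/fl_piP; exact: LE_liexx.
- elim/fl_ind=> x; elim/fl_ind=> y; elim/fl_ind=> z.
  rewrite (lie_piE y z) (lie_piE z x) (lie_piE x y).
  rewrite (lie_piE x) (lie_piE y) (lie_piE z) (fl_addD (LLie y _)) fl_addD.
  by apply/fl_piP; exact: LE_jacobi.
Qed.

Lemma free_lie_universal (V : lmodType K) (b : V -> V -> V) (f : X -> V) :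
  is_lie_bracket b ->
  exists! h : L -> V,
    [/\ forall i, h (fl_var K i) = f i, forall u v, h (u + v) = h u + h v,
        forall k u, h (k *: u) = k *: h u &
        forall u v, h (lie u v) = b (h u) (h v)].
Proof.
move=> [bDl bDr bZl bZr bxx bJ].
pose g := fix g (t : lie_term K X) : V := match t with
  | LVar i => f i | LZero => 0 | LAdd x y => g x + g y
  | LScale k x => k *: g x | LLie x y => b (g x) (g y) end.
have gP x y : lie_eq x y -> g x = g y.
  elim=> //=.
  - by move=> ? ? ? ? -> _ ->.
  - by move=> ? ? ? ? _ -> _ ->.
  - by move=> ? ? ? _ ->.
  - by move=> ? ? ? ? _ -> _ ->.
  - by move=> *; rewrite addrA.
  - by move=> *; rewrite addrC.
  - by move=> *; rewrite add0r.
  - by move=> *; rewrite scaleN1r addNr.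
  - by move=> *; rewrite scalerA.
  - by move=> *; rewrite scale1r.
  - by move=> *; rewrite scalerDr.
  - by move=> *; rewrite scalerDl.
have gE x : g (repr (fl_pi x)) = g x by apply/gP/repr_pi.
exists (fun u => g (repr u)); split.
  split=> [i|||].
  - by rewrite gE.
  - by elim/fl_ind=> x; elim/fl_ind=> y; rewrite fl_addD !gE.
  - by move=> k; elim/fl_ind=> x; rewrite fl_scaleD !gE.
  - by elim/fl_ind=> x; elim/fl_ind=> y; rewrite lie_piE !gE.
move=> h [hv hD hZ hb]; apply/funext; elim/fl_ind=> x; rewrite gE.
elim: x => [i||x IHx y IHy|k x IHx|x IHx y IHy] /=.
- by rewrite -hv.
- have -> : fl_pi (LZero K X) = 0 by [].
  by rewrite -(scale0r (0 : L)) hZ scale0r.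
- by rewrite -fl_addD hD IHx IHy.
- by rewrite -fl_scaleD hZ IHx.
- by rewrite -lie_piE hb IHx IHy.
Qed.

End FreeLieTheory.

Fixpoint ev (K : numFieldType) (X : Type) (t : Br X) : free_lie K X :=
  match t with
  | Leaf x => fl_var K x
  | Node l m => lie (ev K l) (ev K m)
  end.

Section Hall.
Variable X : Type.
Implicit Types (B : set (Br X)) (lt : Br X -> Br X -> Prop).

Record total_order_on B lt : Prop := TotalOrderOn {
  total_irr : forall a, B a -> ~ lt a a;
  total_trans :
    forall b a c, B a -> B b -> B c -> lt a b -> lt b c -> lt a c;
  total_cmp : forall a b, B a -> B b -> [\/ lt a b, a = b | lt b a]
}.

Record is_hall_set B lt : Prop := IsHallSet {
  hall_order : total_order_on B lt;
  hall_letter : forall x, B (Leaf x);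
  hall_node : forall b1 b2, B (Node b1 b2) <->
    [/\ B b1, B b2, lt b1 b2 &
        match b2 with
        | Leaf _ => True
        | Node l _ => lt l b1 \/ l = b1
        end];
  hall_lt_node :
    forall b1 b2, B b1 -> B b2 -> B (Node b1 b2) -> lt b1 (Node b1 b2)
}.

(* [rel_fold B a b] is meant for a < b in the Hall set [B]; then the          *)
(* leaf case of the match is never reached, since (a, x) is a Hall element    *)
(* for every letter x > a.                                                    *)
Fixpoint rel_fold B (a b : Br X) : Br (Br X) :=
  if `[< B (Node a b) >] then Leaf b
  else match b with
       | Leaf _ => Leaf b
       | Node l m => Node (rel_fold B a l) (rel_fold B a m)
       end.

Definition theta B (a b : Br X) : nat := leaves (rel_fold B a b).

Variable K : numFieldType.

Definition is_hall_coords B (u : free_lie K X) (alpha : Br X -> K) : Prop :=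
  [/\ finite_set [set c | alpha c != 0],
      [set c | alpha c != 0] `<=` B &
      u = \sum_(c \in B) alpha c *: ev K c].

(* For a Hall set [B], coordinates exist and are unique by Viennot's theorem. *)
Definition hall_coords B (u : free_lie K X) : Br X -> K :=
  xget (fun=> 0) [set alpha | is_hall_coords B u alpha].

(* The norm is valued in the nonnegative reals of [K].                        *)
Definition hall_norm B (u : free_lie K X) : K :=
  \sum_(c \in B) `|hall_coords B u c|.

End Hall.

(* Main.v *)
(* Write a = f 0 and L_n = ((..((f 1, f 2), f 3)..), f (n+1)) for an injective *)
(* sequence of letters f.  The order puts trees containing a but not f 1       *)
(* first, then those containing f 1 but not a, then those containing neither,  *)
(* where larger indices come first, then those containing both.  From          *)
(*   [a, (L, x)] = -[x, [a, L]] - [(a, x), L]                                  *)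
(* the bracket [a, L_n] expands, with the constant sign (-1)^n, into a sum of  *)
(* Hall trees: in the first term x, being smaller than everything in the       *)
(* relevant class, is distributed over all the leaves of each tree of [a, L],  *)
(* and in the second one (a, x) plays the role of a.  The number of trees with *)
(* g + 1 such leaves is therefore the falling factorial n (n-1) .. (n-g+1),    *)
(* and these numbers add up to the integral part of e n!.                      *)
(*                                                                             *)
(* Coordinates are read off thanks to the linear independence of Hall bases:   *)
(* words act on themselves by concatenation, exchanging the leftmost rise of a *)
(* sequence of Hall trees shows that the products of decreasing sequences span *)
(* all words, and a decreasing sequence is determined by its underlying word,  *)
(* so that in each finite set of words there are not more products than words. *)

Require Import Defs.
From mathcomp Require Import all_boot all_order all_algebra.
From mathcomp Require Import all_classical all_reals all_analysis.
From mathcomp Require Import wochoice zify ring.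

Set Implicit Arguments.
Unset Strict Implicit.
Unset Printing Implicit Defensive.

Import Order.TTheory GRing.Theory Num.Theory.
Import numFieldNormedType.Exports.
Local Open Scope classical_set_scope.
Local Open Scope ring_scope.

(** * The integral part of e m! *)

(** With [m = n - 1], the sum of the falling factorials [m ^_ g] for [g <= m] is [m!] times a
    partial sum of the series of e whose remainder is smaller than [1 / m!]; hence it is the
    integral part of [e m!] ([floor_expR1_fact]). It remains to write [[a, b]], up to one global
    sign, as a sum of that many Hall trees. For [b] a left comb, every composite left comb inside
    [b] has its left part above [a], so the folding goes down to the letters ([theta_comb]). The
    derivation rule expands [[a, b]] without sign changes ([lie_comb]), the order makes every term a
    Hall tree ([expansion_spread], [spread_hall]), and [count_expansion] counts the terms. That the
    norm equals the number of terms, repetitions included ([hall_norm_sum]), needs the independence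
    of Hall trees ([hall_free]). It follows from a rank count: decreasing products span the words,
    and each is determined by its word ([foliages_decreasing_inj]). *)

Lemma sum_ffact_rec m :
  (\sum_(g < m.+2) m.+1 ^_ g = 1 + m.+1 * \sum_(g < m.+1) m ^_ g)%N.
Proof.
by rewrite big_ord_recl ffactn0 big_distrr.
Qed.

Section FloorE.
Variable R : realType.

Let S (m : nat) : R := \sum_(0 <= k < m) k`!%:R^-1.

Lemma sum_ffactE m : (\sum_(g < m.+1) m ^_ g)%N%:R = m`!%:R * S m.+1 :> R.
Proof.
elim: m => [|m IH]; first by rewrite /S big_ord1 big_nat1 invr1 mulr1.
rewrite sum_ffact_rec natrD natrM IH /S [in RHS]big_nat_recr //= mulrDr.
by rewrite mulfV ?pnatr_eq0 -?lt0n ?fact_gt0 // addrC factS natrM !mulrA.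
Qed.

Let cvgS : S @ \oo --> (expR 1 : R).
Proof.
have -> : S = series (exp_coeff 1).
  by apply/funext => m; apply: eq_bigr => k _; rewrite exp_coeffE expr1n mulr1.
exact: is_cvg_series_exp_coeff.
Qed.

Let ndS m m' : (m <= m')%N -> S m <= S m'.
Proof.
by move=> mm; rewrite /S (big_cat_nat _ mm) //= lerDl sumr_ge0.
Qed.

Let U m : R := S m.+1 + m`!%:R^-1.

(** The difference is [2 / (m+1)! - (m+1) / (m+1)!]. *)
Let U_step m : (0 < m)%N -> U m.+1 <= U m ?= iff (m == 1)%N.
Proof.
move=> m0; rewrite /U /S [X in X + _ <= _ ?= iff _]big_nat_recr //= -addrA.
have f0 k : 0 < k`!%:R :> R by rewrite ltr0n fact_gt0.
have -> : m`!%:R^-1 = m.+1%:R / m.+1`!%:R :> R.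
  by rewrite factS natrM invfM mulrA mulfV ?mul1r // pnatr_eq0.
rewrite -mulr2n -(mulr_natl _ 2).
apply/leifP; case: eqP => [->//|/eqP m1].
rewrite ltrD2l ltr_pM2r ?invr_gt0 // ltr_nat.
by case: m m0 m1 => [|[]].
Qed.

(** As [U 1 = U 2], strictness takes two steps: e is at most [U m.+2], which is smaller than
    [U m]. *)
Let expR1_ltU m : (0 < m)%N -> expR 1 < U m.
Proof.
move=> m0; have niU k : (m.+2 <= k.+2)%N -> U k.+2 <= U m.+2.
  elim: k => [|k IH]; first by rewrite !ltnS leqn0 => /eqP->.
  rewrite leq_eqVlt => /predU1P[[->]//|mk].
  by apply: le_trans (IH mk); apply: (U_step _).1.
have h2 : U m.+2 < U m.
  apply: (@lt_le_trans _ _ (U m.+1)); last exact: (U_step m0).1.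
  by rewrite lt_neqAle (U_step _).1 // (U_step _).2 // andbT; case: m m0 {niU}.
apply: le_lt_trans h2; rewrite -(cvg_lim _ cvgS) //.
apply: limr_le; first by apply/cvg_ex; exists (expR 1).
exists m.+3 => // -[|[|[|k]]] //= mk.
by apply: le_trans (niU k _) => //; rewrite /U lerDl invr_ge0.
Qed.

Lemma floor_expR1_fact m : (0 < m)%N ->
  Num.floor (expR (1 : R) * m`!%:R) = (\sum_(g < m.+1) m ^_ g)%N%:Z.
Proof.
move=> m0; apply/eqP; rewrite floor_eq -[(_ + 1)%R]/(_ + 1%:Z) -PoszD -!pmulrn.
have f0 k : 0 < k`!%:R :> R by rewrite ltr0n fact_gt0.
rewrite natrD sum_ffactE [_`!%:R * S _]mulrC -[X in _ + X](mulfV (lt0r_neq0 (f0 m))).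
rewrite [_`!%:R / _]mulrC -mulrDl ler_pM2r // ltr_pM2r // expR1_ltU // andbT.
rewrite -(cvg_lim _ cvgS) //; apply: limr_ge.
  by apply/cvg_ex; exists (expR 1).
by exists m.+1 => // k /=; exact: ndS.
Qed.
End FloorE.

(** * Standard and decreasing sequences of Hall trees *)

Fixpoint foliage (X : Type) (t : Br X) : seq X :=
  match t with
  | Leaf x => [:: x]
  | Node l m => foliage l ++ foliage m
  end.

(** Leaves count too, so that the measure in [merges_from_letters] also drops when a letter passes
    to the tail. *)
Fixpoint nodes (X : Type) (t : Br X) : nat :=
  match t with
  | Leaf _ => 1%N
  | Node l m => (nodes l + nodes m).+1%N
  end.

Definition foliages (X : Type) (s : seq (Br X)) : seq X :=
  flatten (map (@foliage X) s).

Lemma foliages_cat (X : Type) (s1 s2 : seq (Br X)) :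
  foliages (s1 ++ s2) = foliages s1 ++ foliages s2.
Proof. by rewrite /foliages map_cat flatten_cat. Qed.

Lemma foliages_letters (X : Type) (w : seq X) :
  foliages (map (@Leaf X) w) = w.
Proof. by elim: w => //= x w IH; rewrite /foliages /= -/(foliages _) IH. Qed.

Section HallSequences.
Variables (X : Type) (B : set (Br X)) (lt : Br X -> Br X -> Prop).
Hypothesis hallB : is_hall_set B lt.
Implicit Types (s p q d : seq (Br X)) (t u v : Br X).

Let ltb u v : bool := `[< lt u v >].
Let geb u v : bool := ~~ ltb u v.
Let inB s : bool := all (fun t => `[< B t >]) s.

Let ordB : total_order_on B lt := hall_order hallB.

Let ltb_trans u v w : B u -> B v -> B w -> ltb u v -> ltb v w -> ltb u w.
Proof.
move=> Bu Bv Bw /asboolP uv /asboolP vw; apply/asboolP.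
exact: (total_trans ordB Bu Bv Bw uv vw).
Qed.

Let ltb_asym u v : B u -> B v -> ltb u v -> geb v u.
Proof.
move=> Bu Bv uv; apply/negP => vu.
by apply: (total_irr ordB Bu); apply/asboolP/(ltb_trans Bu Bv Bu uv vu).
Qed.

Let geb_trans u v w : B u -> B v -> B w -> geb u v -> geb v w -> geb u w.
Proof.
move=> Bu Bv Bw nuv nvw; apply/negP => uw.
have [/asboolP|vu|/asboolP] := total_cmp ordB Bu Bv.
- by rewrite -/(ltb u v) (negPf nuv).
- by move: nvw; rewrite /geb -vu uw.
- by move=> vu; move: nvw; rewrite /geb (ltb_trans Bv Bu Bw vu uw).
Qed.

Let legal u v : bool := if v is Node l _ then geb u l else true.

(** The left part of each composite tree is at most every tree standing before it. In [decreasing],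
    equal trees may be repeated. *)
Definition standard s : bool := pairwise legal s.
Definition decreasing s : bool := pairwise geb s.

Let BnodeP u v : B (Node u v) <-> [/\ B u, B v, ltb u v & legal u v].
Proof.
rewrite (hall_node hallB); split=> [[Bu Bv uv h]|[Bu Bv /asboolP uv h]].
  split=> //; first exact/asboolP.
  case: v h Bv uv => //= l m h /(hall_node hallB)[Bl Bm _ _] _.
  case: h => [/asboolP/ltb_asym|->]; first exact.
  by apply/negP => /asboolP; exact: (total_irr ordB Bu).
split=> //; case: v h Bv uv => //= l m h /(hall_node hallB)[Bl Bm _ _] _.
have [/asboolP ul|<-|lu] := total_cmp ordB Bu Bl; [|by right|by left].
by move: h; rewrite /geb /ltb ul.
Qed.

Let Bleft u v : B (Node u v) -> ltb u (Node u v).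
Proof.
move=> Buv; have /BnodeP[Bu Bv _ _] := Buv.
exact/asboolP/(hall_lt_node hallB).
Qed.

Let legal_geb u v : B u -> B v -> geb u v -> legal u v.
Proof.
case: v => // l m Bu Bv uv; have /BnodeP[Bl _ _ _] := Bv.
by apply: (geb_trans Bu Bv Bl uv); exact/ltb_asym/Bleft.
Qed.

Let geb_legal u v w : B u -> B v -> B w -> geb u v -> legal v w -> legal u w.
Proof.
case: w => // l m Bu Bv /BnodeP[Bl _ _ _] uv vl; exact: geb_trans vl.
Qed.

Lemma decreasing_standard d : inB d -> decreasing d -> standard d.
Proof.
elim: d => //= t d IH /andP[/asboolP Bt Bd] /andP[td dd].
apply/andP; split; last exact: IH.
move/allP: Bd => Bd; move: td => /(all_filterP) td.
have : all (fun v => `[< B v >] && geb t v) d.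
  by apply/allP => v vd; rewrite Bd //=; move: vd; rewrite -td mem_filter => /andP[].
by apply: sub_all => v /andP[/asboolP Bv]; exact: legal_geb.
Qed.

Variant leftmost_rise s : Prop :=
  LeftmostRise p u v q of s = p ++ u :: v :: q &
    decreasing (rcons p u) & ltb u v.

Lemma leftmost_riseP s : inB s -> decreasing s \/ leftmost_rise s.
Proof.
elim/last_ind: s => [|s v IH]; first by left.
rewrite /inB all_rcons => /andP[/asboolP Bv Bs].
have [ds|[p u w q -> dp uw]] := IH Bs; last first.
  by right; exists p u w (rcons q v) => //; rewrite rcons_cat.
case/lastP: s ds Bs {IH} => [|p u] ds Bs; first by left.
case uv : (ltb u v).
  by right; exists p u v [::] => //; rewrite -!cats1 -catA.
left; rewrite {1}/decreasing -[rcons _ v]cats1 pairwise_cat -/(decreasing _) ds.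
rewrite /= andbT allrel1r.
move: Bs; rewrite /inB all_rcons => /andP[/asboolP Bu Bp].
move: ds; rewrite /decreasing -cats1 pairwise_cat allrel1r => /and3P[pu _ _].
rewrite all_cat /= andbT {2}/geb uv andbT.
have : all (fun h => `[< B h >] && geb h u) p by rewrite all_predI Bp.
apply: sub_all => h /andP[/asboolP Bh hu].
by apply: (geb_trans Bh Bu Bv hu); rewrite /geb uv.
Qed.

(** * Merging and exchanging at the leftmost rise *)

Section Rise.
Variables (p q : seq (Br X)) (u v : Br X).
Hypotheses (Bs : inB (p ++ u :: v :: q)) (ss : standard (p ++ u :: v :: q))
  (dp : decreasing (rcons p u)) (uv : ltb u v).

Let BB : [/\ inB p, B u, B v & inB q].
Proof.
by move: Bs; rewrite /inB all_cat /= => /and4P[? /asboolP ? /asboolP ? ?].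
Qed.

Lemma rise_node : B (Node u v).
Proof.
have [Bp Bu Bv Bq] := BB; apply/BnodeP; split=> //.
by move: ss; rewrite /standard pairwise_cat /= => /and3P[_ _ /andP[/andP[]]].
Qed.

(** The left part [u] of the new tree is at most every tree of [p], since [rcons p u] is decreasing;
    before [q], the new tree replaces the smaller [u]. *)
Lemma standard_merge : standard (p ++ Node u v :: q).
Proof.
have [Bp Bu Bv Bq] := BB; have Buv := rise_node.
move: ss; rewrite /standard !pairwise_cat !allrel_consr /=.
move=> /and3P[/and3P[_ _ ->] -> /and3P[/andP[_ uq] _ ->]] /=; rewrite !andbT.
apply/andP; split.
  by move: dp; rewrite /decreasing -cats1 pairwise_cat allrel1r => /andP[].
have : all (fun h => `[< B h >] && legal u h) q by rewrite all_predI -/(inB q) Bq.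
apply: sub_all => h /andP[/asboolP Bh].
by apply: geb_legal => //; exact/ltb_asym/Bleft.
Qed.

Lemma standard_swap : standard (p ++ v :: u :: q).
Proof.
have [Bp Bu Bv Bq] := BB.
move: ss; rewrite /standard !pairwise_cat !allrel_consr /=.
move=> /and3P[/and3P[-> -> ->] -> /and3P[/andP[_ ->] -> ->]] /=; rewrite !andbT.
exact/legal_geb/ltb_asym.
Qed.

End Rise.

(** All increasing pairs count, not only adjacent ones, so that an exchange lowers the number. *)
Fixpoint rises s : nat :=
  (if s is t :: s' then count (ltb t) s' + rises s' else 0)%N.

Lemma rises_swap p u v q : B u -> B v -> ltb u v ->
  (rises (p ++ v :: u :: q) < rises (p ++ u :: v :: q))%N.
Proof.
move=> Bu Bv uv; elim: p => [|t p IH] /=.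
  by rewrite uv (negPf (ltb_asym Bu Bv uv)) /= add0n add1n addnCA.
by rewrite !count_cat /= (addnCA (ltb t u)) ltn_add2l.
Qed.

Variant merge_step s s' : Prop :=
  MergeStep p u v q of s = p ++ u :: v :: q & s' = p ++ Node u v :: q &
    decreasing (rcons p u) & ltb u v.

Lemma decreasing_no_step d d' : decreasing d -> ~ merge_step d d'.
Proof.
move=> dd st; case: st dd => p u v q -> _ _ uv.
by rewrite /decreasing pairwise_cat /= /geb uv /= !andbF.
Qed.

Lemma merge_step_det s s1 s2 : merge_step s s1 -> merge_step s s2 -> s1 = s2.
Proof.
case=> p u v q -> -> dp uv; case=> p' u' v' q' + -> dp' uv'.
elim: p p' dp dp' => [|t p IH] [|t' p'] /=.
- by move=> _ _ [-> -> ->].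
- move=> _ dp' [ut]; subst t'; case: p' dp' => [|t2 p'] /=.
    by rewrite /decreasing /= => + [vu]; rewrite -vu {1}/geb uv.
  by rewrite /decreasing /= => + [vt]; rewrite -vt {1}/geb uv.
- move=> dp _ [tu]; subst t; case: p dp {IH} => [|t2 p] /=.
    by rewrite /decreasing /= => + [uv2]; rewrite uv2 {1}/geb uv'.
  by rewrite /decreasing /= => + [tv]; rewrite tv {1}/geb uv'.
- move=> /andP[_ dp] /andP[_ dp'] [-> e].
  by congr (_ :: _); exact: IH.
Qed.

Inductive merges : seq (Br X) -> seq (Br X) -> Prop :=
  | MergesRefl s : merges s s
  | MergesStep s s1 s2 : merge_step s s1 -> merges s1 s2 -> merges s s2.

Lemma merges_rcons s s1 s2 : merges s s1 -> merge_step s1 s2 -> merges s s2.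
Proof.
move=> ms st; elim: ms st => [s3|s3 s4 s5 st' _ IH] st.
  by apply: MergesStep st _; exact: MergesRefl.
exact: MergesStep st' (IH st).
Qed.

Lemma merges_decreasing_det s d d' :
  merges s d -> merges s d' -> decreasing d -> decreasing d' -> d = d'.
Proof.
move=> ms; elim: ms d' => [s1|s1 s2 s3 st _ IH] d' ms' dd dd'.
  by case: ms' dd => // s4 s5 s6 st _ /decreasing_no_step /(_ st).
apply: IH => //; case: ms' st dd' => [s4 st /decreasing_no_step /(_ st)//|].
by move=> s4 s5 s6 st' ms' st; rewrite (merge_step_det st st').
Qed.

(* Going backwards, one splits the rightmost composite tree: what precedes it *)
(* is decreasing, so its left part creates the leftmost rise.                 *)
Lemma merges_from_letters p t (w : seq X) :
  inB (p ++ t :: map (@Leaf X) w) -> standard (p ++ t :: map (@Leaf X) w) ->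
  decreasing p ->
  merges (map (@Leaf X) (foliages (p ++ t :: map (@Leaf X) w)))
    (p ++ t :: map (@Leaf X) w).
Proof.
have [n le_n] := ubnP (sumn (map (@nodes X) (rcons p t))).
elim: n => // n IH in p t w le_n *; rewrite map_rcons sumn_rcons in le_n.
case: t le_n => [x|u v] le_n Bs ss dp.
  case/lastP: p => [|p t] in le_n Bs ss dp *.
    by rewrite (foliages_letters (x :: w)); exact: MergesRefl.
  rewrite cat_rcons in Bs ss *.
  apply: (IH p t (x :: w)) => //.
    by move: le_n; rewrite /= addn1 ltnS.
  by move: dp; rewrite /decreasing -cats1 pairwise_cat => /and3P[].
have [Bp Buv Bw] : [/\ inB p, B (Node u v) & inB (map (@Leaf X) w)].
  by move: Bs; rewrite /inB all_cat /= => /and3P[? /asboolP ? ?].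
have [Bu Bv uv luv] := (BnodeP u v).1 Buv.
have [pu sp] : all (geb^~ u) p /\ standard p.
  by move: ss; rewrite /standard pairwise_cat allrel_consr => /and3P[/andP[]].
have dpu : decreasing (rcons p u).
  by rewrite /decreasing -cats1 pairwise_cat allrel1r pu -/(decreasing p) dp.
have lw r : allrel legal r (map (@Leaf X) w).
  by elim: (w) => [|x w' IHw]; rewrite ?allrel0r //= allrel_consr IHw all_predT.
have sw : standard (map (@Leaf X) w).
  by elim: (w) => //= x w' ->; rewrite andbT all_map; exact: all_predT.
have BpP : all (fun h => `[< B h >] && geb h u) p.
  by rewrite all_predI -/(inB p) Bp.
have := IH (rcons p u) v w.
rewrite !cat_rcons.
have -> : foliages (p ++ Node u v :: map (@Leaf X) w) =
          foliages (p ++ u :: v :: map (@Leaf X) w).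
  by rewrite !foliages_cat; congr (_ ++ _); rewrite /foliages /= catA.
move=> H; apply: (@merges_rcons _ (p ++ u :: v :: map (@Leaf X) w)); last first.
  by exists p u v (map (@Leaf X) w).
apply: H => //.
- by rewrite !map_rcons !sumn_rcons; move: le_n; rewrite ltnS /= addnS addnA.
- by rewrite /inB all_cat /=; apply/and4P; split=> //; exact/asboolP.
- rewrite /standard pairwise_cat !allrel_consr /= lw -/(standard p) sp.
  rewrite -/(standard (map _ w)) sw luv !andbT /=.
  have -> /= : all (legal u) (map (@Leaf X) w) by rewrite all_map; exact: all_predT.
  have -> /= : all (legal v) (map (@Leaf X) w) by rewrite all_map; exact: all_predT.
  rewrite !andbT; apply/andP; split; apply: sub_all BpP => h /andP[/asboolP Bh hu].
    exact: legal_geb.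
  exact: (@geb_legal h u v).
Qed.

(** Merging at the leftmost rise is deterministic and cannot continue from a decreasing sequence, so
    both are the normal form of the same word. *)
Lemma foliages_decreasing_inj d d' : inB d -> inB d' ->
  decreasing d -> decreasing d' -> foliages d = foliages d' -> d = d'.
Proof.
have H e : inB e -> decreasing e -> merges (map (@Leaf X) (foliages e)) e.
  move=> Be de; have se := decreasing_standard Be de.
  case/lastP: e => [|p t] in Be de se *; first exact: MergesRefl.
  have := @merges_from_letters p t [::]; rewrite /= cats1; apply=> //.
  by move: de; rewrite /decreasing -cats1 pairwise_cat => /and3P[].
move=> Bd Bd' dd dd' e; apply: (@merges_decreasing_det (map (@Leaf X) (foliages d))) => //.
  exact: H.
by rewrite e; exact: H.
Qed.

Lemma inB_letters (w : seq X) : inB (map (@Leaf X) w).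
Proof. by elim: w => //= x w ->; rewrite andbT; exact/asboolP/(hall_letter hallB). Qed.

Lemma standard_letters (w : seq X) : standard (map (@Leaf X) w).
Proof. by elim: w => //= x w ->; rewrite andbT all_map; exact: all_predT. Qed.

(* Exchanging the two trees of the leftmost rise creates the merged sequence  *)
(* as a correction term, and both new sequences are again standard.           *)
Lemma standard_ind (P : seq (Br X) -> Prop) :
  (forall d, inB d -> decreasing d -> P d) ->
  (forall p u v q, inB (p ++ u :: v :: q) ->
     P (p ++ v :: u :: q) -> P (p ++ Node u v :: q) -> P (p ++ u :: v :: q)) ->
  forall s, inB s -> standard s -> P s.
Proof.
move=> Pd Pr s; have [n le_n] := ubnP (size s).
elim: n => // n IHn in s le_n *; have [r le_r] := ubnP (rises s).
elim: r => // r IHr in s le_n le_r * => Bs ss.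
have [ds|[p u v q es dp uv]] := leftmost_riseP Bs; first exact: Pd.
subst s; have Buv := rise_node Bs ss uv.
have [Bp Bu Bv Bq] : [/\ inB p, B u, B v & inB q].
  by move: Bs; rewrite /inB all_cat /= => /and4P[? /asboolP ? /asboolP ? ?].
apply: Pr => //.
- apply: IHr.
  + by move: le_n; rewrite !size_cat.
  + by rewrite -ltnS; apply: leq_trans le_r; rewrite ltnS; exact: rises_swap.
  + by rewrite /inB all_cat /=; apply/and4P; split=> //; exact/asboolP.
  + exact: standard_swap.
- apply: IHn.
  + by move: le_n; rewrite !size_cat /= !addnS !ltnS.
  + by rewrite /inB all_cat /=; apply/and3P; split=> //; exact/asboolP.
  + exact: standard_merge.
Qed.

End HallSequences.

(** * Linear independence of Hall trees *)

Section Independence.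
Variables (K : numFieldType) (X : eqType).
Variables (B : set (Br X)) (lt : Br X -> Br X -> Prop).
Hypothesis hallB : is_hall_set B lt.

Lemma mulmx_lie_bracket n :
  is_lie_bracket (fun A C : 'M[K]_n => A *m C - C *m A).
Proof.
split=> [u v w|u v w|k u v|k u v|u|u v w].
- by rewrite mulmxDl mulmxDr opprD addrACA.
- by rewrite mulmxDl mulmxDr opprD addrACA.
- by rewrite -scalemxAl -scalemxAr scalerBr.
- by rewrite -scalemxAl -scalemxAr scalerBr.
- by rewrite subrr.
- rewrite !(mulmxBl, mulmxBr, mulmxA).
  by apply/matrixP => i j; rewrite !mxE; ring.
Qed.

Section WordAction.
Variable W : seq (seq X).
Hypothesis W_uniq : uniq W.
Hypothesis W_prefix : forall w x, rcons w x \in W -> w \in W.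
Hypothesis W_perm : forall w w', perm_eq w w' -> w \in W -> w' \in W.
Local Notation D := (size W).

(** Words outside [W] give the zero vector, so [Mx x] is right concatenation truncated to [W]. *)
Let wv (w : seq X) : 'rV[K]_D := \row_j (nth [::] W j == w)%:R.
Let Mx (x : X) : 'M[K]_D :=
  \matrix_(i, j) (nth [::] W j == rcons (nth [::] W i) x)%:R.

Let wv_Mx w x : wv w *m Mx x = wv (rcons w x).
Proof.
apply/rowP => j; rewrite !mxE.
have [wW|wW] := boolP (w \in W).
  have iW : (index w W < D)%N by rewrite index_mem.
  rewrite (bigD1 (Ordinal iW)) //= !mxE /= nth_index // eqxx mul1r.
  rewrite big1 ?addr0 // => i ii; rewrite !mxE.
  case: eqP => [e|]; rewrite ?mul0r //; case/eqP: ii; apply: val_inj => /=.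
  by rewrite -e index_uniq.
rewrite big1 => [|i _]; last first.
  rewrite !mxE; case: eqP => [e|]; rewrite ?mul0r //.
  by move: wW; rewrite -e mem_nth.
case: eqP => // e; case/negP: wW; apply: (@W_prefix w x).
by rewrite -e mem_nth.
Qed.

Let M := fix M (t : Br X) : 'M[K]_D :=
  match t with
  | Leaf x => Mx x
  | Node l m => M l *m M m - M m *m M l
  end.

Let act (u : 'rV[K]_D) (s : seq (Br X)) := foldl (fun u t => u *m M t) u s.
Let v (s : seq (Br X)) := act (wv [::]) s.

Let actD u u' s : act (u + u') s = act u s + act u' s.
Proof. by elim: s u u' => //= t s IH u u'; rewrite mulmxDl IH. Qed.

Let v_rise p t t' q : v (p ++ t :: t' :: q) =
  v (p ++ t' :: t :: q) + v (p ++ Node t t' :: q).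
Proof.
rewrite /v /act !foldl_cat /= -/(act _ _) -actD; congr (act _ _).
by rewrite mulmxBr !mulmxA addrC subrK.
Qed.

Let v_letters w : v (map (@Leaf X) w) = wv w.
Proof.
elim/last_ind: w => [|w x IH] //.
rewrite map_rcons /v /act -[rcons (map _ _) _]cats1 foldl_cat /=.
by rewrite -/(act _ _) -/(v _) IH wv_Mx.
Qed.

Let inB s : bool := all (fun t => `[< B t >]) s.
(** The default [[::]] is harmless: [Q] only has to be square, with every decreasing product over
    [W] among its rows. *)
Let dec_of (w : seq X) : seq (Br X) :=
  xget [::] [set d | [/\ inB d, decreasing lt d & foliages d = w]].

Let dec_ofE d : inB d -> decreasing lt d -> dec_of (foliages d) = d.
Proof.
move=> Bd dd; apply: xget_unique => // d' [Bd' dd' e].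
exact: (foliages_decreasing_inj hallB).
Qed.

Let Q : 'M[K]_D := \matrix_(i < D) v (dec_of (nth [::] W i)).

Let row_Q d (iW : (index (foliages d) W < D)%N) : inB d -> decreasing lt d ->
  row (Ordinal iW) Q = v d.
Proof. by move=> Bd dd; rewrite rowK /= nth_index -?index_mem // dec_ofE. Qed.

Let v_span s : inB s -> standard lt s -> foliages s \in W -> (v s <= Q)%MS.
Proof.
move: s; apply: (standard_ind hallB) => [d Bd dd|p t t' q _ IH1 IH2].
  by rewrite -index_mem => dW; rewrite -(row_Q dW) // row_sub.
move=> fW; rewrite v_rise; apply: addmx_sub; [apply: IH1|apply: IH2].
  (* An exchange permutes the underlying word, whereas a merge keeps it. *)
  apply: W_perm fW; rewrite !foliages_cat perm_cat2l /foliages /= !catA.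
  by rewrite perm_cat2r perm_catC.
by move: fW; rewrite !foliages_cat /foliages /= -!catA.
Qed.

(** The rows span all words of [W], and there are as many rows as words. *)
Let Q_free : row_free Q.
Proof.
rewrite -row_leq_rank; have : row_full Q; last by rewrite /row_full => /eqP->.
rewrite -sub1mx; apply/row_subP => i.
have <- : v (map (@Leaf X) (nth [::] W i)) = row i 1%:M.
  rewrite v_letters; apply/rowP => j; rewrite !mxE nth_uniq //.
  by rewrite eq_sym.
apply: v_span; first exact: (inB_letters hallB).
  exact: standard_letters.
by rewrite foliages_letters mem_nth.
Qed.

Lemma hall_free_words (C : seq (Br X)) (al : Br X -> K) : uniq C ->
  (forall c, c \in C -> B c /\ foliage c \in W) ->
  \sum_(c <- C) al c *: ev K c = 0 -> forall c, c \in C -> al c = 0.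
Proof.
move=> uC BC sum0 c0 c0C.
have [h [[hx hD hZ hl] _]] := free_lie_universal Mx (mulmx_lie_bracket D).
have hev t : h (ev K t) = M t by elim: t => //= l IHl m IHm; rewrite hl IHl IHm.
have h0 : h 0 = 0 by rewrite -(scale0r 0) hZ scale0r.
pose e c : 'rV[K]_D := \row_j (nth [::] W j == foliage c)%:R.
have eQ c : c \in C -> e c *m Q = v [:: c].
  move=> /BC[Bc cW].
  have fc : foliages [:: c] = foliage c by rewrite /foliages /= cats0.
  have iW : (index (foliages [:: c]) W < D)%N by rewrite index_mem fc.
  rewrite -(row_Q iW) //; last by rewrite /inB /= andbT; exact/asboolP.
  rewrite rowE; congr (_ *m _); apply/rowP => j; rewrite !mxE /=.
  rewrite -val_eqE /= fc; congr (_%:R); congr nat_of_bool.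
  by rewrite -{1}(nth_index [::] cW) nth_uniq ?index_mem.
(* The relation, represented by matrices, is applied to the empty word; each Hall tree [c] then
   yields the row of [Q] indexed by its foliage. *)
have : (\sum_(c <- C) al c *: e c) *m Q = 0.
  rewrite mulmx_suml.
  rewrite (eq_big_seq (fun c => wv [::] *m (al c *: M c))); last first.
    by move=> c cC; rewrite -scalemxAl eQ // -scalemxAr.
  rewrite -mulmx_sumr.
  suff -> : \sum_(c <- C) al c *: M c = 0 by rewrite mulmx0.
  rewrite -[RHS]h0 -sum0.
  elim: (C) => [|c C' IH]; first by rewrite !big_nil h0.
  by rewrite !big_cons hD hZ hev IH.
rewrite -[RHS](mul0mx _ Q) => /(row_free_inj Q_free).
have [_ c0W] := BC _ c0C.
have iW : (index (foliage c0) W < D)%N by rewrite index_mem.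
move/rowP => /(_ (Ordinal iW)); rewrite summxE mxE (bigD1_seq c0) //=.
rewrite !mxE /= nth_index // eqxx mulr1 big_seq_cond big1 ?addr0 //.
move=> c /andP[cC cc0]; rewrite !mxE nth_index //.
case: eqP => [fe|]; rewrite ?mulr0 //; case/eqP: cc0.
have [Bc _] := BC _ cC; have [Bc0 _] := BC _ c0C.
(* A single tree is a decreasing sequence, so distinct Hall trees have distinct foliages. *)
suff [] : [:: c] = [:: c0] by [].
apply: (foliages_decreasing_inj hallB) => //=.
- by rewrite andbT; exact/asboolP.
- by rewrite andbT; exact/asboolP.
- by rewrite /foliages /= !cats0.
Qed.

End WordAction.

Fixpoint words (ls : seq X) (n : nat) : seq (seq X) :=
  if n is n'.+1 then [::] :: [seq x :: w | x <- ls, w <- words ls n']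
  else [:: [::]].

Lemma mem_words ls n w :
  (w \in words ls n) = (size w <= n)%N && all (mem ls) w.
Proof.
elim: n w => [|n IH] [|x w] //=; rewrite in_cons /= ltnS.
apply/allpairsP/andP => [[[y w'] [/= yl + [-> ->]]]|[nw /andP[xl lw]]].
  by rewrite IH => /andP[-> ->]; rewrite andbT.
by exists (x, w); split=> //=; rewrite IH nw.
Qed.

Theorem hall_free (C : seq (Br X)) (al : Br X -> K) : uniq C ->
  (forall c, c \in C -> B c) ->
  \sum_(c <- C) al c *: ev K c = 0 -> forall c, c \in C -> al c = 0.
Proof.
move=> uC BC; pose ls := flatten (map (@foliage X) C).
pose W := undup (words ls (size ls)).
apply: (@hall_free_words W); rewrite ?undup_uniq //.
- move=> w x; rewrite !mem_undup !mem_words size_rcons all_rcons.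
  by move=> /andP[/ltnW-> /andP[_ ->]].
- by move=> w w' ww'; rewrite !mem_undup !mem_words (perm_size ww') (perm_all _ ww').
- move=> c cC; split; first exact: BC.
  have sub : {subset foliage c <= ls}.
    by move=> x xc; apply/flatten_mapP; exists c.
  rewrite mem_undup mem_words; apply/andP; split; last exact/allP.
  rewrite /ls size_flatten /shape -map_comp sumnE big_map.
  by rewrite (bigD1_seq c) //= leq_addr.
Qed.

End Independence.

(** * Identities in a Lie algebra *)

Section LieBracket.
Variables (K : numFieldType) (V : lmodType K) (b : V -> V -> V).
Hypothesis b_lie : is_lie_bracket b.

Lemma lie_bracketC u v : b u v = - b v u.
Proof.
have := lie_bracketxx b_lie (u + v).
rewrite (lie_bracketDl b_lie) !(lie_bracketDr b_lie) !(lie_bracketxx b_lie).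
by rewrite add0r addr0 => /eqP; rewrite addr_eq0 => /eqP.
Qed.

Lemma lie_bracketNr u v : b u (- v) = - b u v.
Proof. by rewrite -scaleN1r (lie_bracketZr b_lie) scaleN1r. Qed.

Lemma lie_bracket_sumr (I : Type) (r : seq I) (F : I -> V) u :
  b u (\sum_(i <- r) F i) = \sum_(i <- r) b u (F i).
Proof.
elim: r => [|i r IH]; last by rewrite !big_cons (lie_bracketDr b_lie) IH.
by rewrite !big_nil -(scale0r 0) (lie_bracketZr b_lie) !scale0r.
Qed.

Lemma lie_bracket_suml (I : Type) (r : seq I) (F : I -> V) u :
  b (\sum_(i <- r) F i) u = \sum_(i <- r) b (F i) u.
Proof.
rewrite lie_bracketC lie_bracket_sumr -sumrN.
by apply: eq_bigr => i _; rewrite -lie_bracketC.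
Qed.

Lemma lie_bracket_derivation u v w : b u (b v w) = b (b u v) w + b v (b u w).
Proof.
have /eqP := lie_jacobi b_lie u v w.
rewrite (lie_bracketC w u) lie_bracketNr (lie_bracketC w) -opprD subr_eq0.
by rewrite addrC => /eqP.
Qed.

End LieBracket.

(** * The norm of a signed sum of Hall trees *)

Section Norm.
Variables (K : numFieldType) (X : eqType).
Variables (B : set (Br X)) (lt : Br X -> Br X -> Prop).
Hypothesis hallB : is_hall_set B lt.

Lemma hall_combinationE (C : seq (Br X)) (al : Br X -> K) :
  uniq C -> [set c | al c != 0] `<=` B -> [set c | al c != 0] `<=` [set` C] ->
  \sum_(c \in B) al c *: ev K c = \sum_(c <- C) al c *: ev K c.
Proof.
move=> uC aB aC; rewrite fsbig_supp; apply: fsbig_fwiden => // c /=.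
  by move=> [_ /eqP ac]; apply: aC => /=; apply: contra_neq ac => ->; rewrite scale0r.
move=> [_ nc]; have [->|ac] := eqVneq (al c) 0; first by rewrite scale0r.
by apply: contrapT => nz; apply: nc; split=> //; exact: aB.
Qed.

Lemma hall_coords_unique (u : free_lie K X) (al be : Br X -> K) :
  is_hall_coords B u al -> is_hall_coords B u be -> al = be.
Proof.
move=> [/finite_seqP[s1 e1] aB ->] [/finite_seqP[s2 e2] bB].
pose C := undup (s1 ++ s2); have uC : uniq C by exact: undup_uniq.
have aC : [set c | al c != 0] `<=` [set` C].
  by rewrite e1 => c /=; rewrite mem_undup mem_cat => ->.
have bC : [set c | be c != 0] `<=` [set` C].
  by rewrite e2 => c /=; rewrite mem_undup mem_cat => ->; rewrite orbT.
rewrite (hall_combinationE uC aB aC) (hall_combinationE uC bB bC) => /eqP.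
rewrite -subr_eq0 -sumrB => /eqP e.
have CB c : c \in C -> B c.
  rewrite mem_undup mem_cat => /orP[cs|cs]; [apply: aB|apply: bB].
    by rewrite e1.
  by rewrite e2.
have h := @hall_free K X B lt hallB C (fun c => al c - be c) uC CB.
apply/funext => c; have [cC|cC] := boolP (c \in C).
  apply/eqP; rewrite -subr_eq0; apply/eqP/h => //.
  by rewrite -[RHS]e; apply: eq_bigr => i _; rewrite scalerBl.
have -> : al c = 0 by apply: contraNeq cC => /aC.
by apply/esym; apply: contraNeq cC => /bC.
Qed.

(** The coordinates are [k] times the multiplicities in [s], so nothing cancels. *)
Lemma hall_norm_sum (k : K) (s : seq (Br X)) :
  `|k| = 1 -> (forall t, t \in s -> B t) ->
  hall_norm B (k *: \sum_(t <- s) ev K t) = (size s)%:R.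
Proof.
move=> k1 sB; pose al c : K := k * (count_mem c s)%:R.
have supp c : al c != 0 -> c \in undup s.
  rewrite mem_undup; apply: contraNT => /count_memPn.
  by rewrite /al => ->; rewrite mulr0.
have aB : [set c | al c != 0] `<=` B.
  by move=> c /supp; rewrite mem_undup; exact: sB.
have coords : is_hall_coords B (k *: \sum_(t <- s) ev K t) al.
  split=> //; first by apply: (@sub_finite_set _ _ [set` undup s]) => // c /supp.
  rewrite (hall_combinationE (undup_uniq s) aB) // scaler_sumr.
  rewrite -[in LHS]big_undup_iterop_count.
  by apply: eq_bigr => c _; rewrite /al -scalerA scaler_nat -scalerMnr.
rewrite /hall_norm; have -> : hall_coords B (k *: \sum_(t <- s) ev K t) = al.
  apply: xget_unique => // be hb; exact: hall_coords_unique hb coords.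
rewrite fsbig_supp (fsbig_fwiden (undup s)); first last.
- move=> c [_ nc] /=; have [->|ac] := eqVneq (al c) 0; first by rewrite normr0.
  by apply: contrapT => nz; apply: nc; split=> //; exact: aB.
- exact: undup_uniq.
- by move=> c [_ /eqP]; rewrite normr_eq0 => /supp.
under eq_bigr do rewrite /al normrM k1 mul1r normr_nat.
rewrite -natr_sum; congr (_%:R).
rewrite -[RHS]sum1_size -[RHS]big_undup_iterop_count.
by apply: eq_bigr => c _; elim: (count_mem c s) => // n {1}->; case: n.
Qed.

End Norm.

(** Supplies the order that breaks ties in [tree_lt]. *)
Lemma total_order_exists (T : eqType) :
  exists R : rel T, [/\ transitive R, total R & antisymmetric R].
Proof.
have [R wo] := well_ordering_principle T; exists R.
have wc : wo_chain R predT by move=> A _; exact: wo.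
have tot : total R by move=> x y; exact: (wo_chainW wc).
have anti : antisymmetric R by move=> x y; exact: (wo_chain_antisymmetric wc).
split=> // y x z xy yz.
(* Transitivity comes from the least element of the three. *)
have [|m [[]]] := wo [mem [:: x; y; z]]; first by exists x; rewrite !inE eqxx.
rewrite !inE => /or3P[] /eqP-> lb _.
- by apply: lb; rewrite !inE eqxx !orbT.
- have yx : R y x by apply: lb; rewrite !inE eqxx.
  by rewrite (anti x y) ?xy.
- have zy : R z y by apply: lb; rewrite !inE eqxx !orbT.
  by rewrite (anti z y) ?zy.
Qed.

(** * The Hall set and the expansion of [a, L_n] *)

Section Construction.
Variables (X : eqType) (ix : X -> nat) (R : rel (Br X)).
Hypotheses (R_trans : transitive R) (R_total : total R) (R_anti : antisymmetric R).
Implicit Types (s t u p q y : Br X).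

Fixpoint has_index (i : nat) t : bool :=
  match t with
  | Leaf x => ix x == i
  | Node l m => has_index i l || has_index i m
  end.

Fixpoint min_index t : nat :=
  match t with
  | Leaf x => ix x
  | Node l m => minn (min_index l) (min_index m)
  end.

Definition tree_class t : nat :=
  (if has_index 0 t then if has_index 1 t then 3 else 0
   else if has_index 1 t then 1 else 2)%N.

Definition key_lt s t : bool :=
  (tree_class s < tree_class t)%N ||
  (tree_class s == tree_class t) && (min_index t < min_index s)%N.

Definition key_eq s t : bool :=
  (tree_class s == tree_class t) && (min_index s == min_index t).

Definition tree_lt s t : bool :=
  key_lt s t || key_eq s t &&
  ((leaves s < leaves t)%N || (leaves s == leaves t) && (s != t) && R s t).

Lemma tree_lt_irr t : ~~ tree_lt t t.
Proof. by rewrite /tree_lt /key_lt !ltnn !eqxx /= !andbF. Qed.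

Lemma tree_lt_total s t : [\/ tree_lt s t, s = t | tree_lt t s].
Proof.
have [->|st] := eqVneq s t; first exact: Or32.
have [] : tree_lt s t \/ tree_lt t s; [|by constructor 1|by constructor 3].
apply/orP; move: (R_total s t) st; rewrite /tree_lt /key_lt /key_eq eq_sym.
move: (R s t) (R t s) (t == s) => r1 r2 e; lia.
Qed.

Lemma tree_lt_trans : transitive tree_lt.
Proof.
move=> t s u; rewrite /tree_lt /key_lt /key_eq.
have : (s != t) && R s t -> (t != u) && R t u -> (s != u) && R s u.
  move=> /andP[st Rst] /andP[tu Rtu]; rewrite (R_trans Rst Rtu) andbT.
  by apply: contra_neq st => e; apply: R_anti; rewrite Rst e Rtu.
move: (R s t) (R t u) (R s u) (s == t) (t == u) (s == u) => r1 r2 r3 e1 e2 e3; lia.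
Qed.

(** Given [s < t], the class of the node is at least that of [s]. If the classes agree, its minimal
    index is not larger, and if these agree too, it has more leaves. *)
Lemma tree_lt_node s t : tree_lt s t -> tree_lt s (Node s t).
Proof.
rewrite /tree_lt /key_lt /key_eq /= => h.
have ls : (0 < leaves t)%N by elim: t {h} => //= l hl m hm; rewrite addn_gt0 hl.
move: h; rewrite /tree_class /=.
case: (has_index 0 s); case: (has_index 0 t);
  case: (has_index 1 s); case: (has_index 1 t) => //=; lia.
Qed.

Fixpoint hall_tree t : bool :=
  match t with
  | Leaf _ => true
  | Node l m => [&& hall_tree l, hall_tree m, tree_lt l m &
                 if m is Node l' _ then ~~ tree_lt l l' else true]
  end.

Lemma hall_tree_hall_set :
  is_hall_set [set t | hall_tree t] (fun s t => tree_lt s t).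
Proof.
split=> //.
- split=> [a _|b a c _ _ _|a b _ _]; [|exact: tree_lt_trans|exact: tree_lt_total].
  exact/negP/tree_lt_irr.
- move=> b1 b2 /=; split=> [/and4P[h1 h2 h12 h]|[h1 h2 h12 h]].
    split=> //; case: b2 h {h2 h12} => // l _ nh.
    by have [e|->|e] := tree_lt_total b1 l; [rewrite e in nh|right|left].
  rewrite h1 h2 h12 /=; case: b2 h {h2 h12} => // l _ [h|->].
    by apply/negP => /(tree_lt_trans h); apply/negP/tree_lt_irr.
  exact: tree_lt_irr.
- by move=> b1 b2 _ _ /and4P[_ _ h _]; exact: tree_lt_node.
Qed.

(** * Inserting a letter into a Hall tree *)

Definition is_index1_leaf t : bool := if t is Leaf x then ix x == 1%N else false.

(* The trees (a, f 1) count as leaves: y, being larger than a, forms a Hall   *)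
(* pair with them.                                                            *)
Fixpoint insertions y t : seq (Br X) :=
  match t with
  | Leaf _ => [:: Node y t]
  | Node p q => if is_index1_leaf q then [:: Node y t] else
      [seq Node p' q | p' <- insertions y p] ++
      [seq Node p q' | q' <- insertions y q]
  end.

Fixpoint fold_size t : nat :=
  match t with
  | Leaf _ => 1%N
  | Node p q => if is_index1_leaf q then 1%N else (fold_size p + fold_size q)%N
  end.

Lemma size_insertions y t : size (insertions y t) = fold_size t.
Proof.
elim: t => //= p IHp q IHq; case: ifP => // _.
by rewrite size_cat !size_map IHp IHq.
Qed.

(* The Hall trees whose bracket with any letter of index larger than m is     *)
(* the sum of all the insertions of that letter, again of this shape.         *)
Inductive spread (m : nat) : Br X -> Prop :=
  | SpreadLeaf x : (2 <= ix x <= m)%N -> spread m (Leaf x)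
  | SpreadBase a x : ix x = 1%N -> hall_tree a -> tree_class a = 0%N ->
      spread m (Node a (Leaf x))
  | SpreadNode p q : spread m p -> spread m q -> tree_class p = 2%N ->
      key_lt p q -> (if q is Node q1 _ then key_lt q1 p else true) ->
      spread m (Node p q).

Lemma spread_leq m m' t : (m <= m')%N -> spread m t -> spread m' t.
Proof.
move=> mm; elim=> [x /andP[x2 xm]|a x x1 ha ca|p q _ IHp _ IHq cp pq qp].
- by apply: SpreadLeaf; rewrite x2 (leq_trans xm).
- exact: SpreadBase.
- exact: SpreadNode.
Qed.

Lemma tree_class_leaf x : (2 <= ix x)%N -> tree_class (Leaf x) = 2%N.
Proof. by rewrite /tree_class /=; case: (ix x) => [|[|]]. Qed.

Lemma class0P t : tree_class t = 0%N -> has_index 0 t /\ ~~ has_index 1 t.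
Proof. by rewrite /tree_class; do 2 case: ifP. Qed.

Lemma tree_class_base a x : ix x = 1%N -> tree_class a = 0%N ->
  tree_class (Node a (Leaf x)) = 3%N.
Proof. by move=> x1 /class0P[h _]; rewrite /tree_class /= h x1 orbT. Qed.

Lemma tree_class_nodel p q : tree_class p = 2%N ->
  tree_class (Node p q) = tree_class q.
Proof.
rewrite {1}/tree_class; do 2 case: ifP => //; move=> h1 h0 _.
by rewrite /tree_class /= h0 h1.
Qed.

Lemma spread_index1 m t : spread m t -> is_index1_leaf t = false.
Proof. by case=> // x /andP[x2 _] /=; case: (ix x) x2 => [//|[]]. Qed.

Lemma spread_min_index m t : (0 < m)%N -> spread m t -> (min_index t <= m)%N.
Proof.
move=> m0; elim=> [x /andP[]//|a x x1 _ _|p q _ IHp _ _ _ _ _] /=.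
  by rewrite x1 geq_min m0 orbT.
by rewrite geq_min IHp.
Qed.

Lemma key_tree_lt s t : key_lt s t -> tree_lt s t.
Proof. by rewrite /tree_lt => ->. Qed.

Lemma spread_hall m t : spread m t -> hall_tree t.
Proof.
elim=> //= [a x x1 -> ca|p q _ -> _ -> cp pq qp] /=.
  rewrite andbT; apply: key_tree_lt; rewrite /key_lt ca.
  by rewrite /tree_class /= x1.
rewrite key_tree_lt //=; case: q qp {pq} => // q1 q2 qp.
by apply/negP => /(tree_lt_trans (key_tree_lt qp)); apply/negP/tree_lt_irr.
Qed.

(** Inserting a letter of class 2 and large index keeps the class and the minimal index, so
    comparisons by key survive. The last clause controls the new left part, as required when [t] is
    itself a right subtree. *)
Lemma spread_insertions m x t t' : (0 < m < ix x)%N -> spread m t ->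
  t' \in insertions (Leaf x) t ->
  [/\ spread (ix x) t', key_eq t' t, fold_size t' = (fold_size t).+1 &
      if t' is Node l' _ then
        l' = Leaf x \/ (if t is Node l _ then key_eq l' l else false)
      else false].
Proof.
move=> /andP[m0 mx]; set y := Leaf x.
have x2 : (2 <= ix x)%N by exact: leq_ltn_trans mx.
have cy : tree_class y = 2%N by rewrite tree_class_leaf.
have sy : spread (ix x) y by apply: SpreadLeaf; rewrite x2 leqnn.
have up s : spread m s -> spread (ix x) s by apply: spread_leq; exact: ltnW.
have keyy s : min_index s = minn (ix x) (min_index s) -> key_eq (Node y s) s.
  by move=> e; rewrite /key_eq tree_class_nodel // eqxx /= -e.
have yx1 : is_index1_leaf y = false by exact: spread_index1 sy.
move=> st; elim: st t' => [z /andP[z2 zm]|a z z1 ha ca|p q sp IHp sq IHq cp pq qp] t'.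
- rewrite inE => /eqP->; have zx : (ix z < ix x)%N by exact: leq_ltn_trans mx.
  split=> /=; last by left.
  + apply: SpreadNode => //; first by apply: up; apply: SpreadLeaf; rewrite z2.
    by rewrite /key_lt cy tree_class_leaf // eqxx /= zx orbT.
  + by apply: keyy; apply/esym/minn_idPr/ltnW.
  + by case: eqP z2 => // ->.
- rewrite /= z1 eqxx inE => /eqP->; have c3 := tree_class_base z1 ca.
  split=> /=; last by left.
  + apply: SpreadNode => //; first exact: SpreadBase.
      by rewrite /key_lt cy c3.
    by rewrite /key_lt cy ca.
  + apply: keyy; apply/esym/minn_idPr => /=.
    by rewrite geq_min z1 (ltnW x2) orbT.
  + by rewrite z1.
- rewrite /= (spread_index1 sq) mem_cat => /orP[] /mapP[s' s's ->].
    have [ss' ks' fs' _] := IHp _ s's.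
    split.
    + apply: SpreadNode => //; first exact: up.
      * by move: ks'; rewrite /key_eq cp => /andP[/eqP].
      * by move: ks' pq; rewrite /key_eq /key_lt => /andP[/eqP-> /eqP->].
      * case: (q) qp => // q1 _.
        by move: ks'; rewrite /key_eq /key_lt => /andP[/eqP-> /eqP->].
    + move: ks'; rewrite /key_eq cp => /andP[/eqP cs' /eqP ms'].
      by rewrite !tree_class_nodel // eqxx /= ms'.
    + by rewrite /= (spread_index1 sq) fs'.
    + by right.
  have [ss' ks' fs' ls'] := IHq _ s's.
  split.
  + apply: SpreadNode => //; first exact: up.
      by move: ks' pq; rewrite /key_eq /key_lt => /andP[/eqP-> /eqP->].
    case: s' ls' {ks' fs' ss' s's} => // l' r' [->|].
      (* The new left part is the letter itself, below [p] because larger indices come first. *)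
      rewrite /key_lt cy cp eqxx /=.
      exact: leq_ltn_trans (spread_min_index m0 sp) mx.
    case: (q) qp => // q1 _.
    by rewrite /key_eq /key_lt => + /andP[/eqP-> /eqP->].
  + by move: ks'; rewrite /key_eq !tree_class_nodel //= => /andP[-> /eqP->]; rewrite /= eqxx.
  + by rewrite /= (spread_index1 ss') fs' addnS.
  + by right; rewrite /key_eq !eqxx.
Qed.

(** * The combs and their expansion *)

Variable f : nat -> X.
Hypothesis ixf : forall i, ix (f i) = i.

Fixpoint comb n : Br X :=
  if n is n'.+1 then Node (comb n') (Leaf (f n'.+2)) else Leaf (f 1%N).

Fixpoint expansion a n : seq (Br X) :=
  if n is n'.+1 then
    flatten [seq insertions (Leaf (f n'.+2)) t | t <- expansion a n'] ++
    expansion (Node a (Leaf (f n'.+2))) n'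
  else [:: Node a (Leaf (f 1%N))].

Lemma leaves_comb n : leaves (comb n) = n.+1.
Proof. by elim: n => //= n ->; rewrite addn1. Qed.

Lemma class_comb n : tree_class (comb n) = 1%N.
Proof.
have : has_index 0 (comb n) = false /\ has_index 1 (comb n).
  elim: n => [|n [IH0 IH1]] /=; rewrite ixf //.
  by rewrite IH0 IH1.
by rewrite /tree_class => -[-> ->].
Qed.

Lemma hall_comb n : hall_tree (comb n).
Proof.
elim: n => //= n ->; rewrite andbT key_tree_lt // /key_lt class_comb.
by rewrite tree_class_leaf ?ixf.
Qed.

(** The left part of [comb n.+1] has class 1, hence exceeds [f 0], and the two do not form a Hall
    pair. *)
Lemma theta_comb n : theta [set t | hall_tree t] (Leaf (f 0%N)) (comb n) = n.+1.
Proof.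
rewrite /theta; elim: n => [|n IH] /=; first by case: ifP.
case: ifPn => [/asboolP h|_] /=; last first.
  by case: ifP => _; rewrite /= IH addn1.
have /and4P[_ _ _ /negP[]] : hall_tree (Node (Leaf (f 0%N)) (comb n.+1)) := h.
apply: key_tree_lt.
by rewrite /key_lt class_comb /tree_class /= !ixf.
Qed.

Lemma expansion_spread a n t : hall_tree a -> tree_class a = 0%N ->
  t \in expansion a n -> spread n.+1 t /\ (0 < fold_size t <= n.+1)%N.
Proof.
elim: n a t => [|n IH] a t ha ca /=.
  rewrite inE => /eqP->; split; first by apply: SpreadBase => //; rewrite ixf.
  by rewrite /= ixf.
rewrite mem_cat => /orP[/flatten_mapP[s /(IH _ _ ha ca)[ss /andP[_ fs]]]|].
  move=> /(spread_insertions _ ss)[|sp _ -> _]; first by rewrite ixf ltnSn.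
  by rewrite ixf in sp; split.
set y := Leaf _; have cy : tree_class y = 2%N by rewrite tree_class_leaf ?ixf.
move=> /IH[].
- rewrite /= ha /= andbT; apply: key_tree_lt.
  by rewrite /key_lt ca cy.
- have [h0 h1] := class0P ca.
  by rewrite /tree_class /= ixf h0 (negPf h1).
- move=> sp /andP[-> fs]; split; first exact: spread_leq sp.
  exact: leqW.
Qed.

(** A tree of fold size [g] has [g] insertions, all of fold size [g + 1], and the other summand
    keeps the shape with [a] replaced by [(a, x)]. The counts thus satisfy
    [(n+1) ^_ g = g * n ^_ (g-1) + n ^_ g] for positive [g]. *)
Lemma count_expansion a n g : hall_tree a -> tree_class a = 0%N ->
  count (fun t => fold_size t == g.+1) (expansion a n) = n ^_ g.
Proof.
elim: n a g => [|n IH] a g ha ca /=.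
  by rewrite ixf eqxx /= addn0; case: g.
set y := Leaf _; have cy : tree_class y = 2%N by rewrite tree_class_leaf ?ixf.
rewrite count_cat IH; first last.
- have [h0 h1] := class0P ca.
  by rewrite /tree_class /= ixf h0 (negPf h1).
- rewrite /= ha /= andbT; apply: key_tree_lt.
  by rewrite /key_lt ca cy.
have -> : count (fun t => fold_size t == g.+1)
    (flatten [seq insertions y t | t <- expansion a n]) =
    (g * count (fun t => fold_size t == g) (expansion a n))%N.
  rewrite count_flatten -map_comp sumnE big_map -sum1_count big_distrr /=.
  rewrite [RHS]big_mkcond /=; apply: eq_big_seq => s sE.
  have [ss _] := expansion_spread ha ca sE.
  rewrite (@eq_in_count _ _ (fun=> fold_size s == g)); last first.
    move=> s' /(spread_insertions _ ss)[|_ _ -> _]; first by rewrite ixf ltnSn.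
    by rewrite eqSS.
  case: eqP => [<-|_]; last by rewrite count_pred0.
  by rewrite count_predT size_insertions muln1.
case: g => [|g]; first by rewrite mul0n !ffactn0.
rewrite IH // ffactSS ffactnSr.
have [gn|gn] := leqP g n; last by rewrite ffact_small // !mul0n !muln0.
by rewrite [(n ^_ g * _)%N]mulnC -mulnDl; congr (_ * _)%N; lia.
Qed.

Lemma size_expansion a n : hall_tree a -> tree_class a = 0%N ->
  size (expansion a n) = (\sum_(g < n.+1) n ^_ g)%N.
Proof.
move=> ha ca; under eq_bigr do rewrite -(count_expansion n _ ha ca) -sum1_count big_mkcond.
rewrite exchange_big /= -sum1_size; apply: eq_big_seq => t tE.
have [_] := expansion_spread ha ca tE.
case: (fold_size t) => // k /= kn.
rewrite (bigD1 (Ordinal kn)) //= eqxx big1 // => i.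
by rewrite -val_eqE /= eqSS eq_sym => /negPf->.
Qed.

Variable K : numFieldType.
Local Notation ev := (ev K).

Let lieP : is_lie_bracket (@lie K X) := free_lie_bracket K X.

Lemma lie_ev_insertions y t :
  lie (ev y) (ev t) = \sum_(t' <- insertions y t) ev t'.
Proof.
elim: t => [x|p IHp q IHq] /=; first by rewrite big_seq1.
case: ifP => _; first by rewrite big_seq1.
rewrite (lie_bracket_derivation lieP) IHp IHq big_cat !big_map /=.
by rewrite (lie_bracket_suml lieP) (lie_bracket_sumr lieP).
Qed.

(* Both summands of [a, (L, x)] = -[x, [a, L]] - [(a, x), L] carry the sign   *)
(* -1, so that no cancellation occurs.                                        *)
Lemma lie_comb a n :
  lie (ev a) (ev (comb n)) = (-1) ^+ n *: \sum_(t <- expansion a n) ev t.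
Proof.
elim: n a => [|n IH] a /=; first by rewrite big_seq1 scale1r.
set y := Leaf _; rewrite (lie_bracket_derivation lieP).
rewrite (lie_bracketC lieP _ (ev y)) (lie_bracketC lieP (ev (comb n))) -opprD.
rewrite IH -[lie (ev a) (ev y)]/(ev (Node a y)) IH (lie_bracketZr lieP) -scalerDr.
rewrite exprS mulN1r scaleNr big_cat; congr (- (_ *: (_ + _))).
rewrite (lie_bracket_sumr lieP) big_flatten /= big_map.
by apply: eq_bigr => t _; exact: (lie_ev_insertions y t).
Qed.

Lemma hall_norm_comb n :
  hall_norm [set t | hall_tree t] (lie (ev (Leaf (f 0%N))) (ev (comb n))) =
  (\sum_(g < n.+1) n ^_ g)%N%:R.
Proof.
have c0 : tree_class (Leaf (f 0%N)) = 0%N by rewrite /tree_class /= ixf.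
rewrite lie_comb (hall_norm_sum hall_tree_hall_set) ?size_expansion //.
  by rewrite normrX normrN1 expr1n.
by move=> t /(@expansion_spread (Leaf (f 0%N)) n t isT c0)[/spread_hall].
Qed.

End Construction.

Lemma infinite_injection (X : Type) :
  infinite_set [set: X] -> exists f : nat -> X, injective f.
Proof.
move=> /infiniteP/card_leP[f].
exists (fun i => val (f (SigSub (in_setT i)))) => i j /val_inj e.
have {e} := @inj _ _ _ f (SigSub (in_setT i)) (SigSub (in_setT j))
  (in_setT _) (in_setT _) e.
by move/(congr1 val).
Qed.

Unset Implicit Arguments.

Unset Implicit Arguments.
Set Strict Implicit.
Set Printing Implicit Defensive.

Theorem corollary4p15 (R : realType) (k : base_field) (X : Type)
    (X_infinite : infinite_set [set: X]) :
  exists (B : set (Br X)) (lt : Br X -> Br X -> Prop),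
    is_hall_set B lt /\
    forall n : nat, (2 <= n)%N ->
      exists a b : Br X,
        [/\ B a, B b & lt a b] /\
        [/\ leaves a = 1%N, theta B a b = n, leaves b = n &
            hall_norm B (lie (ev (scalars R k) a) (ev (scalars R k) b))
              = (Num.floor (expR (1 : R) * ((n - 1)`!)%:R))%:~R].
Proof.
have [f f_inj] := infinite_injection X_infinite.
(* Letters outside the range of [f] get index 0; the order still separates letters of equal index by
   the tie-breaking [T]. *)
pose ix (x : X) : nat := xget 0%N [set i | f i = x].
have ixf i : ix (f i) = i.
  by apply: xget_unique => // j fj; exact: f_inj.
have [T [T_trans T_total T_anti]] := total_order_exists (Br {classic X}).
pose hall := @hall_tree {classic X} ix T.
pose less := @tree_lt {classic X} ix T.
exists [set t | hall t], (fun s t => less s t).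
split; first exact: (@hall_tree_hall_set {classic X} ix T).
case=> [//|[//|n]] _.
pose c := @comb {classic X} f.
exists (Leaf (f 0%N)), (c n.+1); split.
  split=> //; first exact: (@hall_comb {classic X} ix T f ixf).
  apply: (@key_tree_lt {classic X}); rewrite /key_lt (@class_comb {classic X} ix f ixf).
  by rewrite /tree_class /= !ixf.
split=> //; first exact: (@theta_comb {classic X} ix T f ixf).
  exact: (@leaves_comb {classic X} f).
rewrite subn1 /= floor_expR1_fact // -pmulrn.
exact: (@hall_norm_comb {classic X} ix T T_trans T_total T_anti f ixf
  (scalars R k) n.+1).
Qed.
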